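(* Let $\mu$ be a positive Borel measure on $\mathbb{R}$ such that $\int_{\mathbb{R}}\frac{d\mu(x)}{1+x^2}<\infty$. Then $$\left\{y\in\mathrm{supp}(\mu) : \int_{\mathbb{R}}\frac{d\mu(x)}{(x-y)^2}=\infty\right\}$$ is a dense $G_\delta$ set in $\mathrm{supp}(\mu)$.
   Context: $\mathrm{supp}(\mu)$ is the topological support of $\mu$, i.e. the smallest closed set $S\subseteq\mathbb{R}$ with $\mu(\mathbb{R}\setminus S)=0$. The integrand $(x-y)^{-2}$ is taken to be $+\infty$ at $x=y$. *)

(* Defs.v *)
From mathcomp Require Import all_boot all_order all_algebra.
From mathcomp Require Import all_classical all_reals all_analysis.
From mathcomp Require Import measurable_realfun.

Set Implicit Arguments.
Unset Strict Implicit.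
Unset Printing Implicit Defensive.

Import Order.TTheory GRing.Theory Num.Theory.
Import numFieldNormedType.Exports.

Local Open Scope classical_set_scope.
Local Open Scope ring_scope.
Local Open Scope ereal_scope.

(* msupport mu is the intersection of all closed sets with mu-null complement;
   msupport_closed, msupport_null and msupport_smallest show that it is itself
   such a set, so that it is the least one. *)
Definition msupport (R : realType) (mu : {measure set R -> \bar R}) : set R :=
  smallest [set S | closed S /\ mu (~` S) = 0] set0.

Section msupport_lemmas.
Context {R : realType} (mu : {measure set R -> \bar R}).

Lemma msupport_closed : closed (msupport mu).
Proof. by apply: closed_bigI => S [[]]. Qed.

Lemma msupport_smallest (S : set R) :
  closed S -> mu (~` S) = 0 -> msupport mu `<=` S.
Proof. by move=> cS muS; apply: bigcap_inf; split=> //; split. Qed.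

Lemma msupport_null : mu (~` msupport mu) = 0.
Proof.
pose J (q : rat * rat) : set R := `]ratr q.1, ratr q.2[%classic.
pose F n : set R := if unpickle n is Some q then
  if mu (J q) == 0 then J q else set0 else set0.
have mF n : measurable (F n).
  rewrite /F; case: unpickle => [q|//]; case: ifP => // _.
  exact: measurable_itv.
have F0 n : mu (F n) = 0.
  by rewrite /F; case: unpickle => [q|]; [case: ifP => [/eqP|]|]; rewrite ?measure0.
have mS : measurable (~` msupport mu).
  by apply: open_measurable; exact: closed_openC msupport_closed.
have negF : mu.-negligible (\bigcup_n F n).
  by apply: negligible_bigcup => n; apply: (proj2 (negligibleP mu (mF n))); exact: F0.
apply: (proj1 (negligibleP mu mS)).
apply: negligibleS negF.
move=> x; rewrite /msupport /smallest setC_bigcap => -[S [[cS muS] _]] Sx.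
have /nbhs_ballP[e /= e0 xeS] : nbhs x (~` S).
  by apply: open_nbhs_nbhs; split=> //; exact: closed_openC.
have [a] := @rat_in_itvoo R (x - e)%R x ltac:(by rewrite ltrBlDr ltrDl).
have [b] := @rat_in_itvoo R x (x + e)%R ltac:(by rewrite ltrDl).
rewrite !in_itv/= => /andP[xb be] /andP[ea ax].
have muJ : mu (J (a, b)) = 0.
  apply: (@subset_measure0 _ _ _ mu _ (~` S)) => //.
  - exact: measurable_itv.
  - by apply: open_measurable; exact: closed_openC.
  - move=> y; rewrite /J /= in_itv/= => /andP[ay yb]; apply: xeS.
    rewrite ball_itv/= in_itv/=; apply/andP; split.
      exact: lt_trans ea ay.
    exact: lt_trans yb be.
have [n FJ] : exists n, F n = J (a, b).
  by exists (pickle (a, b)); rewrite /F pickleK muJ eqxx.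
by exists n => //; rewrite FJ /J/= in_itv/= ax.
Qed.

End msupport_lemmas.

(* Main.v *)
Require Import Defs.
From mathcomp Require Import all_boot all_order all_algebra.
From mathcomp Require Import all_classical all_reals all_analysis.
From mathcomp Require Import borel_hierarchy measurable_realfun ring lra.
Import Order.TTheory GRing.Theory Num.Theory.
Import numFieldNormedType.Exports.
Local Open Scope classical_set_scope.
Local Open Scope ring_scope.
Local Open Scope ereal_scope.

(** Write F y for the integral of (x - y)^-2 with respect to mu.

    F is lower semicontinuous: it is the increasing limit of the integrals of
    (|x - y| + 1/(n+1))^-2, and the n-th of these kernels stays below
    (x - z)^-2 as long as |y - z| <= 1/(n+1), so a strict lower bound on
    F y persists near y (lower_semicontinuous_inv_sq_potential).  The set
    where F = +oo is therefore the intersection of the open sets where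
    F > n, which gives the G_delta property.

    Density follows from the stronger fact that F = +oo holds mu-almost
    everywhere (ae_inv_sq_potential_infinite).  If an interval J of length L
    contains a point y with F y <= C, then the kernel is at least L^-2 on J,
    hence mu J <= C L^2.  So the trace of mu on the set A where F <= C gives
    mass O(L^2) to every interval of length L; subdividing an interval into 2^k
    equal pieces costs a factor 2^k and gains 4^-k, so mu A = 0
    (measure0_quadratic).  An open set U such that F is finite at all points
    of U in the support is then mu-null, hence disjoint from the support. *)

Definition inv_sq {R : realType} (y x : R) : \bar R :=
  (((x - y) ^+ 2)%:E)^-1.

(** Adding 1/(n+1) to |x - y|, instead of truncating the kernel, makes the
    comparison with the kernel centred at a nearby point a mere triangle
    inequality. *)
Definition inv_sq_reg {R : realType} (y : R) (n : nat) (x : R) : \bar R :=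
  (((`|x - y| + n.+1%:R^-1) ^+ 2)^-1)%:E.

Lemma inv_sq_ge0 {R : realType} (y x : R) : 0 <= inv_sq y x.
Proof. by rewrite inve_ge0 lee_fin sqr_ge0. Qed.

Lemma inv_sq_reg_ge0 {R : realType} (y : R) n x : 0 <= inv_sq_reg y n x.
Proof. by rewrite lee_fin invr_ge0 sqr_ge0. Qed.

Lemma le_inv_sq {R : realType} (y x r : R) :
  (0 < r)%R -> (`|x - y| <= r)%R -> ((r ^+ 2)^-1)%:E <= inv_sq y x.
Proof.
move=> r0 xyr; rewrite /inv_sq inver; case: ifPn => [_|xy0]; first exact: leey.
rewrite lee_fin lef_pV2 ?posrE;
  [|by rewrite exprn_gt0|by rewrite lt0r xy0 sqr_ge0].
by rewrite -(real_normK (num_real (x - y))) lerXn2r ?nnegrE// ltW.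
Qed.

(** At x = y the right-hand side is the inverse of 0 in the extended reals,
    that is +oo, and the left-hand side is (n+1)^2; elsewhere this is
    continuity of the inverse. *)
Lemma inv_sq_reg_cvg {R : realType} (y x : R) :
  inv_sq_reg y n x @[n --> \oo] --> inv_sq y x.
Proof.
rewrite /inv_sq /inv_sq_reg; have [->|xy] := eqVneq x y.
  rewrite subrr expr0n/= inve0 normr0; apply/cvgeryP/cvgryPge => A.
  near=> n; rewrite add0r exprVn invrK.
  have : (A <= n%:R)%R by near: n; exact: nbhs_infty_ger.
  move=> /le_trans; apply; rewrite -natrX ler_nat.
  by rewrite (leq_trans (leqnSn n))// leq_pmulr.
have xy0 : (`|x - y| ^+ 2 != 0)%R by rewrite expf_eq0/= normr_eq0 subr_eq0.
rewrite -(real_normK (num_real (x - y))) inver (negbTE xy0).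
apply: cvg_EFin; first exact: nearW.
apply: cvgV => //.
have cvg_dist : (`|x - y| + n.+1%:R^-1)%R @[n --> \oo] --> `|x - y|%R.
  rewrite -[X in _ --> X]addr0.
  by apply: cvgD; [exact: cvg_cst|exact: cvg_harmonic].
exact: (cvg_comp _ _ cvg_dist (@exprn_continuous R 2 _)).
Unshelve. all: by end_near. Qed.

Lemma inv_sq_reg_nondecreasing {R : realType} (y x : R) :
  nondecreasing_seq (inv_sq_reg y ^~ x).
Proof.
move=> m n mn; rewrite lee_fin lef_pV2 ?posrE ?exprn_gt0 ?ltr_wpDl//.
rewrite lerXn2r ?nnegrE ?addr_ge0// lerD2l lef_pV2 ?posrE//.
by rewrite ler_nat.
Qed.

Lemma measurable_inv_sq_reg {R : realType} (y : R) n :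
  measurable_fun setT (inv_sq_reg y n).
Proof.
apply/measurable_EFinP.
apply: continuous_measurable_fun => x.
apply: cvgV; first by rewrite expf_eq0/= gt_eqF// ltr_wpDl.
have cvg_dist : (`|z - y| + n.+1%:R^-1)%R @[z --> x] -->
    (`|x - y| + n.+1%:R^-1)%R.
  apply: cvgD; last exact: cvg_cst.
  by apply: cvg_norm; apply: cvgB; [exact: cvg_id|exact: cvg_cst].
exact: (cvg_comp _ _ cvg_dist (@exprn_continuous R 2 _)).
Qed.

Lemma measurable_inv_sq {R : realType} (y : R) :
  measurable_fun setT (inv_sq y).
Proof.
apply: (@emeasurable_fun_cvg _ _ _ _ (inv_sq_reg y)).
  exact: measurable_inv_sq_reg.
by move=> x _; exact: inv_sq_reg_cvg.
Qed.

(** By monotone convergence, a < F y is already witnessed by some regularised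
    kernel of index n, which is dominated by the kernel centred at any z within
    1/(n+1) of y. *)
Lemma lower_semicontinuous_inv_sq_potential {R : realType}
  (mu : {measure set R -> \bar R}) :
  lower_semicontinuous (fun y => \int[mu]_x inv_sq y x).
Proof.
move=> y a ay.
have cvgF : \int[mu]_x inv_sq_reg y n x @[n --> \oo] --> \int[mu]_x inv_sq y x.
  rewrite (_ : inv_sq y = fun x => limn (inv_sq_reg y ^~ x)); last first.
    by apply/funext => x; apply/esym/cvg_lim => //; exact: inv_sq_reg_cvg.
  apply: cvg_monotone_convergence => //.
  - exact: measurable_inv_sq_reg.
  - by move=> n x _; exact: inv_sq_reg_ge0.
  - by move=> x _; exact: inv_sq_reg_nondecreasing.
have : nbhs (\int[mu]_x inv_sq y x) [set z | a%:E < z].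
  by apply: open_nbhs_nbhs; split=> //; exact: open_ereal_gt_ereal.
move=> /cvgF[n _ /(_ n (leqnn n))/= an].
exists (ball y n.+1%:R^-1%R); first exact: nbhsx_ballx.
move=> z; rewrite -ball_normE/= => yz; apply: (lt_le_trans an).
apply: ge0_le_integral => //.
- by move=> x _; exact: inv_sq_reg_ge0.
- exact: measurable_inv_sq_reg.
- exact: measurable_inv_sq.
- move=> x _; apply: le_inv_sq; first by rewrite ltr_wpDl.
  by rewrite (le_trans (ler_distD y x z))// lerD2l ltW.
Qed.

(** Halving an interval divides the bound C L^2 by two after summing over the
    halves: 2 C (L/2)^2 = C L^2 / 2.  Iterating this k times bounds the mass of
    every interval by C L^2 / 2^k, for every k. *)
Lemma measure0_quadratic {R : realType} (mu : {measure set R -> \bar R})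
    (A : set R) (C : R) : measurable A ->
  (forall a L : R, (0 < L)%R ->
    mu (A `&` `[a, (a + L)%R[) <= (C * L ^+ 2)%:E) ->
  mu A = 0.
Proof.
move=> mA quad.
have halving k a L : (0 < L)%R ->
    mu (A `&` `[a, (a + L)%R[) <= (C * L ^+ 2 / 2 ^+ k)%:E.
  elim: k a L => [|k IH] a L L0; first by rewrite expr0 divr1; exact: quad.
  have L20 : (0 < L / 2)%R by rewrite divr_gt0.
  have -> : A `&` `[a, (a + L)%R[ =
      (A `&` `[a, (a + L / 2)%R[) `|`
      (A `&` `[(a + L / 2)%R, (a + L / 2 + L / 2)%R[).
    rewrite -setIUr -addrA -splitr; congr setI.
    by rewrite -itv_bndbnd_setU// bnd_simp; lra.
  apply: le_trans; first by apply: measureU2; apply: measurableI.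
  apply: le_trans; first by apply: leeD; exact: IH.
  rewrite -EFinD lee_fin (exprS 2%R k).
  have : (2 ^+ k != 0 :> R)%R by rewrite expf_neq0.
  move: (2 ^+ k)%R => p p0.
  by rewrite le_eqVlt; apply/orP; left; apply/eqP; field.
have null a L : (0 < L)%R -> mu (A `&` `[a, (a + L)%R[) = 0.
  move=> L0; apply/eqP; rewrite eq_le measure_ge0 andbT.
  have : (C * L ^+ 2 / 2 ^+ k)%:E @[k --> \oo] --> 0.
    apply: cvg_EFin; first exact: nearW.
    rewrite -(mulr0 (C * L ^+ 2)%R); apply: cvgMr.
    under eq_fun do rewrite -exprVn.
    by apply: cvg_expr; rewrite ger0_norm// invf_lt1// ltr1n.
  by apply: cvge_ge; near=> k; exact: halving.
have /negligibleP-/(_ mA) : mu.-negligible A; last by [].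
(* [-m, m[ with m = n+1, written as an interval [a, a + L[ with L = 2 m *)
pose J n := `[(- n.+1%:R)%R, (- n.+1%:R + n.+1%:R *+ 2 : R)%R[%classic.
apply: (@negligibleS _ _ _ mu (\bigcup_n (A `&` J n))).
  move=> x Ax.
  have [n xn] : exists n, (`|x| < n.+1%:R)%R.
    by exists (Num.truncn `|x|); rewrite -truncn_le_nat.
  exists n => //; split => //; rewrite /J/= in_itv/=.
  by move: xn; rewrite ltr_norml; lra.
apply: negligible_bigcup => n; apply/negligibleP.
  by apply: measurableI => //; exact: measurable_itv.
by apply: null; rewrite pmulrn_lgt0.
Unshelve. all: by end_near. Qed.

Lemma measurable_inv_sq_potential_le {R : realType}
    (mu : {measure set R -> \bar R}) (C : R) :
  measurable [set y | \int[mu]_x inv_sq y x <= C%:E].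
Proof.
have /lower_semicontinuousP/(_ C)/open_measurable/measurableC :=
  @lower_semicontinuous_inv_sq_potential R mu.
by congr measurable; apply/seteqP; split=> y /=; rewrite leNgt => /negP.
Qed.

(** Where F <= C, the Markov-type bound L^-2 mu J <= F y <= C, for any y in an
    interval J of length L, makes mu quadratically small on short intervals. *)
Lemma ae_inv_sq_potential_infinite {R : realType}
  (mu : {measure set R -> \bar R}) :
  {ae mu, forall y, \int[mu]_x inv_sq y x = +oo}.
Proof.
pose A n := [set y | \int[mu]_x inv_sq y x <= n%:R%:E].
suff An n : mu.-negligible (A n).
  apply: negligibleS (negligible_bigcup An) => y /= /eqP.
  rewrite -ltey => Fy.
  have Ffin : \int[mu]_x inv_sq y x \is a fin_num.
    by rewrite ge0_fin_numE//; apply: integral_ge0 => x _; exact: inv_sq_ge0.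
  exists (Num.truncn (fine (\int[mu]_x inv_sq y x))).+1 => //=.
  by rewrite /A/= -(fineK Ffin) lee_fin ltW// -truncn_le_nat.
have mA : measurable (A n) by exact: measurable_inv_sq_potential_le.
apply/negligibleP => //; apply: (@measure0_quadratic _ _ _ n%:R) => // a L L0.
have [->|/set0P[y [Fy yJ]]] := eqVneq (A n `&` `[a, (a + L)%R[) set0.
  by rewrite measure0 lee_fin mulr_ge0// sqr_ge0.
have L20 : (0 < (L ^+ 2)^-1)%R by rewrite invr_gt0 exprn_gt0.
apply: (@le_trans _ _ (mu `[a, (a + L)%R[%classic)).
  by apply: le_measure; rewrite ?inE//; exact: measurableI.
rewrite -(@lee_pmul2l _ ((L ^+ 2)^-1)%:E)//= -EFinM mulrCA mulVf; last first.
  by rewrite expf_neq0// gt_eqF.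
rewrite mulr1 -integral_cst//; apply: le_trans Fy.
apply: (@le_trans _ _ (\int[mu]_(x in `[a, (a + L)%R[) inv_sq y x)).
  apply: ge0_le_integral => //.
  - by move=> x _; rewrite lee_fin ltW.
  - exact: measurable_funS (measurable_inv_sq y).
  - move=> x xJ; apply: le_inv_sq => //.
    by move: xJ yJ; rewrite /= !in_itv/= ler_norml; lra.
apply: ge0_subset_integral => //; first exact: measurable_inv_sq.
by move=> x _; exact: inv_sq_ge0.
Qed.

Theorem proposition3p4 (R : realType) (mu : {measure set R -> \bar R})
  (hmu : \int[mu]_x ((1 + x ^+ 2)^-1)%:E < +oo) :
  let D : set (msupport mu) :=
    [set y | \int[mu]_x (((x - set_val y) ^+ 2)%:E)^-1 = +oo] in
  dense D /\ Gdelta D.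
Proof.
move=> D; split => [V [y0 +] [U oU UV]|].
  rewrite -{V}UV => Uy0.
  apply: contrapT => UD0.
  have muU : mu U = 0.
    have /negligibleP : mu.-negligible U; last first.
      by apply; exact: open_measurable.
    have mS : measurable (~` msupport mu).
      by apply: open_measurable; apply: closed_openC; exact: msupport_closed.
    have /negligibleP-/(_ mS) negS := msupport_null mu.
    apply: negligibleS (negligibleU (ae_inv_sq_potential_infinite mu) negS).
    move=> y Uy; have [Sy|] := pselect (msupport mu y); last by right.
    left => Fy; apply: UD0.
    by exists (SigSub (mem_set Sy)).
  have : msupport mu `<=` ~` U.
    by apply: msupport_smallest; [exact: open_closedC|rewrite setCK].
  by move=> /(_ _ (set_valP y0)); apply.
exists (fun n => set_val @^-1` [set y : R | n%:R%:E < \int[mu]_x inv_sq y x]).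
  move=> n; exists [set y : R | n%:R%:E < \int[mu]_x inv_sq y x] => //.
  have /lower_semicontinuousP := @lower_semicontinuous_inv_sq_potential R mu.
  exact.
apply/seteqP; split=> [y Fy n _|y Fy].
  by rewrite /preimage/= (_ : \int[mu]_x _ = +oo) ?ltry.
apply/eqyP => r _; have [n rn] : exists n, (r < n%:R)%R.
  by exists (Num.truncn r).+1; rewrite -truncn_le_nat.
by apply: ltW; apply: lt_trans (Fy n I); rewrite lte_fin.
Qed.
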